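(* Let $Q\subset\mathbb{R}^n$ be a nonempty convex compact set, $\|\cdot\|$ a norm on $\mathbb{R}^n$, $d:Q\to\mathbb{R}$ a function that is differentiable at all points of $Q$ and $1$-strongly convex with respect to $\|\cdot\|$, and $V(x,y)=d(x)-d(y)-\langle\nabla d(y),x-y\rangle$ the corresponding Bregman divergence. Let $L>0$, $\delta>0$, $\tilde\delta\ge 0$, $\varepsilon>0$, and let $\psi:Q\times Q\to\mathbb{R}$ satisfy (i) $\psi(\cdot,y)$ is convex on $Q$ for every $y\in Q$; (ii) $\psi(x,x)=0$ for all $x\in Q$; (iii) $\psi(x,y)+\psi(y,x)\le 0$ for all $x,y\in Q$; (iv) $\psi(x,y)\le\psi(x,z)+\psi(z,y)+LV(x,z)+LV(z,y)+\delta$ for all $x,y,z\in Q$. Assume also that there exists $x_*\in Q$ with $\psi(x,x_* )\ge 0$ for all $x\in Q$. Run the adaptive method described in the context on $\psi$ with accuracy $\varepsilon$, inexactness $\tilde\delta$ in the auxiliary problems, $x^0=\arg\min_{x\in Q}d(x)$, and an initial constant $0<L^0\le 2L$, and suppose that it has stopped after $N$ iterations, i.e. $S_N:=\sum_{k=0}^{N-1}\frac{1}{L^{k+1}}\ge\frac{\max_{x\in Q}V(x,x^0)}{\varepsilon}$ (with $N\ge 1$). Then for every $x\in Q$ $$-\frac{1}{S_N}\sum_{k=0}^{N-1}\frac{\psi(x,y^{k+1})}{L^{k+1}}\le\frac{V(x,x^0)}{S_N}+2\tilde\delta+\delta\le\varepsilon+2\tilde\delta+\delta,$$ and also $$\psi(\tilde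 y,x)\le\frac{V(x,x^0)}{S_N}+2\tilde\delta+\delta\le\varepsilon+2\tilde\delta+\delta,\qquad\text{where}\quad \tilde y:=\frac{1}{S_N}\sum_{k=0}^{N-1}\frac{y^{k+1}}{L^{k+1}}.$$
   Context: Inexact minimization: for a convex function $\varphi:Q\to\mathbb{R}$ and $\tilde\delta\ge 0$, the notation $x=\arg\min^{\tilde\delta}_{y\in Q}\varphi(y)$ means that $x\in Q$ and, for some (sub)gradient $\nabla\varphi(x)$ of $\varphi$ at $x$ (i.e. a vector $p$ with $\varphi(y)\ge\varphi(x)+\langle p,y-x\rangle$ for all $y\in Q$), one has $\langle\nabla\varphi(x),x-y\rangle\le\tilde\delta$ for all $y\in Q$. The adaptive method. Start from $x^0=\arg\min_{x\in Q}d(x)$ and a constant $L^0>0$. The $(k+1)$-st iteration ($k=0,1,2,\dots$), given $x^k$ and $L^k$, is as follows. 1. Set $L^{k+1}:=L^k/2$. 2. Compute $$y^{k+1}:=\arg\min_{x\in Q}^{\tilde\delta}\{\psi(x,x^k)+L^{k+1}V(x,x^k)\},\qquad x^{k+1}:=\arg\min_{x\in Q}^{\tilde\delta}\{\psi(x,y^{k+1})+L^{k+1}V(x,x^k)\}.$$ 3. If the inequality $$\psi(x^{k+1},x^k)\le\psi(y^{k+1},x^k)+\psi(x^{k+1},y^{k+1})+L^{k+1}V(y^{k+1},x^k)+L^{k+1}V(x^{k+1},y^{k+1})+\delta$$ fails, replace $L^{k+1}$ by $2L^{k+1}$ and repeat step 2. Otherwise the iteration is complete with the current $L^{k+1},y^{k+1},x^{k+1}$.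 The method stops after $N$ iterations as soon as $\sum_{k=0}^{N-1}\frac{1}{L^{k+1}}\ge\frac{\max_{x\in Q}V(x,x^0)}{\varepsilon}$. All inexact minimizers in the sense above that are used by the method are taken to exist. *)

(* Defs.v *)
(* Functions on Q (resp. Q x Q) are total functions on 'rV[R]_n whose values  *)
(* outside Q are never constrained nor used.                                  *)
From mathcomp Require Import all_boot all_order all_algebra.
From mathcomp Require Import all_classical all_reals all_analysis.

Set Implicit Arguments.
Unset Strict Implicit.
Unset Printing Implicit Defensive.

Import Order.TTheory GRing.Theory Num.Theory.
Import numFieldNormedType.Exports.

Local Open Scope classical_set_scope.
Local Open Scope ring_scope.

Definition dot (R : realType) (n : nat) (u v : 'rV[R]_n) : R :=
  \sum_(i < n) u 0 i * v 0 i.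

(* An arbitrary norm on R^n, not to be confused with the canonical (sup) norm *)
(* `|x| of 'rV[R]_n, which is only used to express the topology.              *)
Record is_norm (R : realType) (n : nat) (nrm : 'rV[R]_n -> R) : Prop := {
  is_norm_ge0 : forall x, 0 <= nrm x ;
  is_norm_eq0 : forall x, nrm x = 0 -> x = 0 ;
  is_normZ : forall (a : R) x, nrm (a *: x) = `|a| * nrm x ;
  is_normD : forall x y, nrm (x + y) <= nrm x + nrm y }.

(* g is a gradient at y of f : Q -> R, i.e.                                   *)
(*   f x = f y + <g, x - y> + o(|x - y|)  as x -> y inside Q.                 *)
(* When Q has empty interior g need not be unique, but <g, x - y> is uniquely *)
(* determined for x in Q when Q is convex.                                    *)
Definition is_gradient (R : realType) (n : nat) (Q : set 'rV[R]_n)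
    (f : 'rV[R]_n -> R) (y g : 'rV[R]_n) : Prop :=
  forall e : R, 0 < e ->
    \forall x \near within Q (nbhs y),
      `|f x - f y - dot g (x - y)| <= e * `|x - y|.

Definition strongly_convex (R : realType) (n : nat) (nrm : 'rV[R]_n -> R)
    (mu : R) (Q : set 'rV[R]_n) (f : 'rV[R]_n -> R) : Prop :=
  forall (x y : 'rV[R]_n) (t : R), Q x -> Q y -> 0 <= t <= 1 ->
    f (t *: x + (1 - t) *: y) <=
      t * f x + (1 - t) * f y - mu / 2 * t * (1 - t) * nrm (x - y) ^+ 2.

(* gd y plays the role of the gradient of d at y. *)
Definition bregman (R : realType) (n : nat) (d : 'rV[R]_n -> R)
    (gd : 'rV[R]_n -> 'rV[R]_n) (x y : 'rV[R]_n) : R :=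
  d x - d y - dot (gd y) (x - y).

Definition is_argmin (R : realType) (n : nat) (Q : set 'rV[R]_n)
    (f : 'rV[R]_n -> R) (x : 'rV[R]_n) : Prop :=
  Q x /\ forall y, Q y -> f x <= f y.

Definition subgradient (R : realType) (n : nat) (Q : set 'rV[R]_n)
    (f : 'rV[R]_n -> R) (x p : 'rV[R]_n) : Prop :=
  forall y, Q y -> f x + dot p (y - x) <= f y.

Definition inexact_argmin (R : realType) (n : nat) (tdelta : R)
    (Q : set 'rV[R]_n) (f : 'rV[R]_n -> R) (x : 'rV[R]_n) : Prop :=
  Q x /\ exists2 p, subgradient Q f x p &
                    forall y, Q y -> dot p (x - y) <= tdelta.

(* The two auxiliary problems solved from the current point xk with trial     *)
(* constant M; the second one is still centred at xk, not at y'.              *)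
Definition trial (R : realType) (n : nat) (tdelta : R) (Q : set 'rV[R]_n)
    (V psi : 'rV[R]_n -> 'rV[R]_n -> R) (xk : 'rV[R]_n) (M : R)
    (y' x' : 'rV[R]_n) : Prop :=
  inexact_argmin tdelta Q (fun x => psi x xk + M * V x xk) y' /\
  inexact_argmin tdelta Q (fun x => psi x y' + M * V x xk) x'.

(* The relative-smoothness inequality along xk, y', x', with M in place of L. *)
Definition accepts (R : realType) (n : nat) (delta : R)
    (V psi : 'rV[R]_n -> 'rV[R]_n -> R) (xk : 'rV[R]_n) (M : R)
    (y' x' : 'rV[R]_n) : Prop :=
  psi x' xk <= psi y' xk + psi x' y' + M * V y' xk + M * V x' y' + delta.

(* search .. xk M M' y' x' : the doubling loop entered with trial constant M  *)
(* may terminate with constant M' and points y', x'.  This is a relation,     *)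
(* since inexact minimizers are not unique.                                   *)
Inductive search (R : realType) (n : nat) (delta tdelta : R)
    (Q : set 'rV[R]_n) (V psi : 'rV[R]_n -> 'rV[R]_n -> R) (xk : 'rV[R]_n) :
    R -> R -> 'rV[R]_n -> 'rV[R]_n -> Prop :=
| search_accept M y' x' :
    trial tdelta Q V psi xk M y' x' ->
    accepts delta V psi xk M y' x' ->
    search delta tdelta Q V psi xk M M y' x'
| search_double M y x M' y' x' :
    trial tdelta Q V psi xk M y x ->
    ~ accepts delta V psi xk M y x ->
    search delta tdelta Q V psi xk (2 * M) M' y' x' ->
    search delta tdelta Q V psi xk M M' y' x'.

(* The first N iterations: xs k = x^k and Ls k = L^k for k <= N, and          *)
(* ys k = y^k for 1 <= k <= N; the other terms are irrelevant.                *)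
Record adaptive_run (R : realType) (n : nat) (delta tdelta : R)
    (Q : set 'rV[R]_n) (V psi : 'rV[R]_n -> 'rV[R]_n -> R)
    (x0 : 'rV[R]_n) (L0 : R) (N : nat)
    (Ls : nat -> R) (ys xs : nat -> 'rV[R]_n) : Prop := {
  run_x0 : xs 0%N = x0 ;
  run_L0 : Ls 0%N = L0 ;
  run_iter : forall k, (k < N)%N ->
    search delta tdelta Q V psi (xs k) (Ls k / 2)
      (Ls k.+1) (ys k.+1) (xs k.+1) }.

Definition inv_sum (R : realType) (Ls : nat -> R) (N : nat) : R :=
  \sum_(k < N) (Ls k.+1)^-1.

(* Main.v *)
(** For a convex function [f], first-order optimality of an inexact minimizer
    [u] of [f + M V(., z)] and the three-point identity for [V] give
    [f u + M V(u,z) + M V(x,u) <= f x + M V(x,z) + tdelta] for all [x] in [Q].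
    Taking [x = x^{k+1}] in the first auxiliary problem, an arbitrary [x] in the
    second, and using the acceptance test, one gets
    [- psi(x, y^{k+1}) / L^{k+1}
       <= V(x, x^k) - V(x, x^{k+1}) + (2 tdelta + delta) / L^{k+1}],
    which telescopes.  Monotonicity and convexity of [psi] then transfer the
    bound to the averaged point. *)
Require Import Defs.
From mathcomp Require Import all_boot all_order all_algebra.
From mathcomp Require Import all_classical all_reals all_analysis.
From mathcomp Require Import ring lra.

Set Implicit Arguments.
Unset Strict Implicit.
Unset Printing Implicit Defensive.

Import Order.TTheory GRing.Theory Num.Theory.
Import numFieldNormedType.Exports.

Local Open Scope classical_set_scope.
Local Open Scope ring_scope.

(** * Linearity and continuity of the inner product *)

Section Dot.
Variables (R : realType) (n : nat).
Implicit Types g u v : 'rV[R]_n.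

Lemma dotDr g u v : dot g (u + v) = dot g u + dot g v.
Proof.
by rewrite /dot -big_split; apply: eq_bigr => i _; rewrite mxE mulrDr.
Qed.

Lemma dotZr g (a : R) u : dot g (a *: u) = a * dot g u.
Proof.
by rewrite /dot mulr_sumr; apply: eq_bigr => i _; rewrite mxE mulrCA.
Qed.

Lemma dotBr g u v : dot g (u - v) = dot g u - dot g v.
Proof. by rewrite dotDr -scaleN1r dotZr mulN1r. Qed.

Lemma dotBl g u v : dot (u - v) g = dot u g - dot v g.
Proof.
rewrite /dot -sumrB; apply: eq_bigr => i _.
by rewrite !mxE mulrDl mulNr.
Qed.

Lemma dot_continuous g : continuous (dot g).
Proof.
have coordM i : continuous (fun u : 'rV[R]_n => g 0 i * u 0 i).
  by move=> u; apply: (@cvgMl_tmp _ _ (nbhs u)); exact: coord_continuous.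
apply: continuous_big => [|i _]; first exact: add_continuous.
exact: coordM.
Qed.

End Dot.

(** * Convex combinations, Jensen's inequality, and gradients along segments of [Q] *)

Section Convexity.
Variables (R : realType) (n : nat) (Q : set 'rV[R]_n).
Hypothesis Q_convex : convex_set (Q : set (convex_lmodType 'rV[R]_n)).
Implicit Types (x y u z : 'rV[R]_n) (f : 'rV[R]_n -> R).

Local Notation convexfun f :=
  (convex_function (Q : set (convex_lmodType 'rV[R]_n)) f).

Lemma convex_set_comb x y (t : R) :
  Q x -> Q y -> 0 <= t <= 1 -> Q (t *: x + (1 - t) *: y).
Proof.
move=> Qx Qy /andP[t0 t1].
have := Q_convex (Itv01 t0 t1) (mem_set Qx) (mem_set Qy).
by move/set_mem.
Qed.

Lemma convex_function_comb f x y (t : R) : convexfun f ->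
  Q x -> Q y -> 0 <= t <= 1 ->
  f (t *: x + (1 - t) *: y) <= t * f x + (1 - t) * f y.
Proof.
move=> fconv Qx Qy /andP[t0 t1].
exact: (fconv (Itv01 t0 t1) _ _ (mem_set Qx) (mem_set Qy)).
Qed.

(** Induction on [N]: the new mean is a convex combination of the old mean and the last point, with
    the old mean weighted by its share [t] of the total mass. Membership [Q m] is carried along
    because convexity of [f] is applied at the old mean. *)
Lemma weighted_jensen f (w : nat -> R) (z : nat -> 'rV[R]_n) (N : nat) :
  convexfun f ->
  (forall k, (k <= N)%N -> 0 < w k) -> (forall k, (k <= N)%N -> Q (z k)) ->
  let S := \sum_(k < N.+1) w k in
  let m := S^-1 *: \sum_(k < N.+1) w k *: z k in
  [/\ 0 < S, Q m & S * f m <= \sum_(k < N.+1) w k * f (z k)].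
Proof.
move=> fconv; elim: N => [|N IH] w_gt0 Qz /=.
  have w0 := w_gt0 0%N (leqnn _).
  rewrite !big_ord1 scalerA mulVf ?gt_eqF// scale1r.
  by split => //; exact: Qz.
have [k kN|k kN|S_gt0 Qm fm] := IH; [exact/w_gt0/leqW|exact/Qz/leqW|].
have wN := w_gt0 N.+1 (leqnn _); have QzN := Qz N.+1 (leqnn _).
rewrite !(big_ord_recr N.+1)/=.
set S := \sum_(i < N.+1) w i in S_gt0 Qm fm *.
set s := \sum_(i < N.+1) w i *: z i in Qm fm *.
have S'_gt0 : 0 < S + w N.+1 by rewrite addr_gt0.
pose t := S / (S + w N.+1).
have t01 : 0 <= t <= 1.
  rewrite /t divr_ge0 ?(ltW S_gt0) ?(ltW S'_gt0)//=.
  by rewrite ler_pdivrMr// mul1r lerDl ltW.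
have t1 : 1 - t = w N.+1 / (S + w N.+1) by rewrite /t; field; rewrite gt_eqF.
have -> : (S + w N.+1)^-1 *: (s + w N.+1 *: z N.+1)
    = t *: (S^-1 *: s) + (1 - t) *: z N.+1.
  rewrite scalerDr !scalerA t1; congr (_ *: _ + _ *: _); last by rewrite mulrC.
  by rewrite /t; field; rewrite !gt_eqF.
split=> //; first exact: convex_set_comb.
have := convex_function_comb fconv Qm QzN t01.
rewrite -(ler_pM2l S'_gt0) => /le_trans; apply.
have -> (a b : R) : (S + w N.+1) * (t * a + (1 - t) * b) = S * a + w N.+1 * b.
  by rewrite t1 /t; field; rewrite gt_eqF.
by rewrite lerD2r.
Qed.

Lemma convex_comb_addE x u (t : R) :
  t *: x + (1 - t) *: u = u + t *: (x - u).
Proof. by rewrite scalerBl scale1r scalerBr addrCA addrC -addrA addrC. Qed.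

(** Extracts from the neighbourhood filter one explicit point of the segment from [u] to [x] where
    the first-order error is at most [e * t]; one such [t] for each [e] is enough to compare
    directional derivatives. *)
Lemma is_gradient_segment f u g x (e : R) :
  is_gradient Q f u g -> Q u -> Q x -> 0 < e ->
  exists2 t, 0 < t <= 1 &
    `|f (t *: x + (1 - t) *: u) - f u - t * dot g (x - u)| <= e * t.
Proof.
move=> fg Qu Qx e_gt0; set v := x - u.
have v1 : 0 < `|v| + 1 by rewrite ltr_wpDl.
(* The denominator absorbs the factor [v] of the increment [t *: v], and the added 1 covers the case
   [x = u]. *)
have /fg : 0 < e / (`|v| + 1) by rewrite divr_gt0.
rewrite near_withinE => /nbhs_ballP[r /= r_gt0 ballP].
have rv_gt0 : 0 < r + `|v| by rewrite ltr_pwDl.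
(* This choice gives both [t <= 1] and norm of [t *: v] below [r], also when [v = 0]. *)
pose t := r / (r + `|v|).
have t_gt0 : 0 < t by rewrite divr_gt0.
have t_le1 : t <= 1 by rewrite /t ler_pdivrMr// mul1r lerDl.
exists t; first by rewrite t_gt0.
have := ballP (t *: x + (1 - t) *: u).
rewrite convex_comb_addE -/v -ball_normE /= opprD addNKr normrN normrZ.
rewrite gtr0_norm//.
have -> : u + t *: v - u = t *: v by rewrite addrAC subrr add0r.
rewrite normrZ gtr0_norm// dotZr => /(_ _ _)/le_trans; apply.
- by rewrite /t mulrAC ltr_pdivrMr// ltr_pM2l// ltrDr.
- by rewrite -convex_comb_addE; apply: convex_set_comb => //; rewrite ltW.
- rewrite mulrCA mulrC ler_pM2r// mulrAC ler_pdivrMr// ler_pM2l//.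
  by rewrite lerDl.
Qed.

(** A lower bound on the difference quotients passes to the directional derivative: for each [e],
    some quotient is within [e] of it. *)
Lemma le_dot_gradient f u g x (c : R) :
  is_gradient Q f u g -> Q u -> Q x ->
  (forall t, 0 < t <= 1 -> t * c <= f (t *: x + (1 - t) *: u) - f u) ->
  c <= dot g (x - u).
Proof.
move=> fg Qu Qx fc; apply/ler_addgt0Pr => e e_gt0.
have [t t01 ft] := is_gradient_segment fg Qu Qx e_gt0.
have t_gt0 : 0 < t by case/andP: t01.
rewrite -(ler_pM2l t_gt0); apply: (le_trans (fc _ t01)).
by move: ft; rewrite ler_distl => /andP[_]; lra.
Qed.

Lemma dot_gradient_le f u g x (c : R) :
  is_gradient Q f u g -> Q u -> Q x ->
  (forall t, 0 < t <= 1 -> f (t *: x + (1 - t) *: u) - f u <= t * c) ->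
  dot g (x - u) <= c.
Proof.
move=> fg Qu Qx fc; apply/ler_addgt0Pr => e e_gt0.
have [t t01 ft] := is_gradient_segment fg Qu Qx e_gt0.
have t_gt0 : 0 < t by case/andP: t01.
rewrite -(ler_pM2l t_gt0).
have := fc _ t01.
by move: ft; rewrite ler_distl => /andP[+ _]; lra.
Qed.

End Convexity.

(** * The Bregman divergence and the inequality for inexact minimizers *)

Section Bregman.
Variables (R : realType) (n : nat) (Q : set 'rV[R]_n).
Variables (d : 'rV[R]_n -> R) (gd : 'rV[R]_n -> 'rV[R]_n).
Hypothesis d_diff : forall y, Q y -> is_gradient Q d y (gd y).
Implicit Types (x y u z : 'rV[R]_n).

Local Notation V := (bregman d gd).

Lemma bregman_three_point x u z :
  dot (gd u - gd z) (x - u) = V x z - V x u - V u z.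
Proof. by rewrite dotBl /bregman !dotBr; ring. Qed.

(** [V ^~ z] is [d] plus an affine function of slope [- gd z], so both have the same first-order
    remainder. *)
Lemma is_gradient_bregman u z : Q u ->
  is_gradient Q (V ^~ z) u (gd u - gd z).
Proof.
move=> Qu e e_gt0; apply: filterS (d_diff Qu e_gt0) => x.
by congr (`|_| <= _); rewrite dotBl /bregman !dotBr; ring.
Qed.

Lemma is_gradient_within_continuous (f : 'rV[R]_n -> R)
    (gf : 'rV[R]_n -> 'rV[R]_n) :
  (forall y, Q y -> is_gradient Q f y (gf y)) -> {within Q, continuous f}.
Proof.
move=> fg; apply/subspace_continuousP => y Qy.
apply/cvgrPdist_le => e e_gt0.
have e2 : 0 < e / 2 by rewrite divr_gt0.
near=> x.
have dx : `|dot (gf y) y - dot (gf y) x| <= e / 2.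
  near: x; apply: cvg_within.
  by have /cvgrPdist_le := @dot_continuous R n (gf y) y; exact.
have xy : `|y - x| <= e / 2.
  near: x; apply: cvg_within.
  by have /cvgrPdist_le : x @[x --> y] --> y by []; exact.
(* The gradient condition with tolerance 1 already bounds the remainder by [e / 2], by [xy]. *)
have : `|f x - f y - dot (gf y) (x - y)| <= 1 * `|x - y|.
  by near: x; exact: fg.
rewrite mul1r (distrC x y) dotBr => fx.
have -> : f y - f x = - (f x - f y - (dot (gf y) x - dot (gf y) y))
    + (dot (gf y) y - dot (gf y) x) by ring.
rewrite (le_trans (ler_normD _ _))// normrN; lra.
Unshelve. all: by end_near.
Qed.

(** Continuity of [V ^~ z] on the compact [Q] makes the [sup] in the stopping rule a genuine
    supremum rather than a default value. *)
Lemma has_sup_bregman z : Q !=set0 -> compact Q ->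
  has_sup [set V x z | x in Q].
Proof.
move=> [q Qq] Q_compact; apply: compact_has_sup; first by exists (V q z), q.
apply: continuous_compact => //.
by apply: is_gradient_within_continuous => y /is_gradient_bregman; exact.
Qed.

Hypothesis Q_convex : convex_set (Q : set (convex_lmodType 'rV[R]_n)).
Variable nrm : 'rV[R]_n -> R.
Hypothesis d_sconvex : strongly_convex nrm 1 Q d.

Lemma bregman_ge0 x z : Q x -> Q z -> 0 <= V x z.
Proof.
(* The quadratic term of strong convexity is nonnegative; dropping it bounds each difference
   quotient of [d] at [z] towards [x] by [d x - d z]. *)
move=> Qx Qz; rewrite /bregman subr_ge0.
apply: (dot_gradient_le Q_convex (d_diff Qz)) => // t /andP[t_gt0 t_le1].
have /(d_sconvex Qx Qz) : 0 <= t <= 1 by rewrite ltW.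
have : 0 <= 1 / 2 * t * (1 - t) * nrm (x - z) ^+ 2.
  have ? : 0 <= 1 / 2 * t by lra.
  by apply: mulr_ge0; rewrite ?sqr_ge0// mulr_ge0// subr_ge0.
lra.
Qed.

(** The subgradient [p] belongs to the whole sum, so it is tested at points [xt] of the segment from
    [u] to [x]. Convexity of [f] bounds its increment by [t * (f x - f u)], which leaves a lower
    bound on the difference quotients of [V ^~ z], hence on its directional derivative. *)
Lemma inexact_argmin_three_point (tdelta M : R) (f : 'rV[R]_n -> R) u z x :
  0 < M -> convex_function (Q : set (convex_lmodType 'rV[R]_n)) f ->
  inexact_argmin tdelta Q (fun y => f y + M * V y z) u -> Q x ->
  f u + M * V u z + M * V x u <= f x + M * V x z + tdelta.
Proof.
move=> M_gt0 fconv [Qu [p psub ptd]] Qx.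
suff : (f u - f x - tdelta) / M <= dot (gd u - gd z) (x - u).
  by rewrite bregman_three_point ler_pdivrMr//; lra.
apply: (le_dot_gradient Q_convex (is_gradient_bregman z Qu)) => //.
move=> t /andP[t_gt0 t_le1].
have t01 : 0 <= t <= 1 by rewrite ltW.
set xt := t *: x + (1 - t) *: u.
have Qxt : Q xt by exact: convex_set_comb.
have := convex_function_comb fconv Qx Qu t01; rewrite -/xt => fxt.
have := psub _ Qxt => /=.
have -> : xt - u = - (t *: (u - x)).
  by rewrite /xt convex_comb_addE addrAC subrr add0r -scalerN opprB.
rewrite -scaleN1r dotZr mulN1r dotZr => sub.
have td : t * dot p (u - x) <= t * tdelta by rewrite ler_pM2l// ptd.
rewrite mulrA ler_pdivrMr//; lra.
Qed.

End Bregman.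

(** * Invariants of the doubling loop and of the run *)

Section Search.
Variables (R : realType) (n : nat) (Q : set 'rV[R]_n).
Variables (V psi : 'rV[R]_n -> 'rV[R]_n -> R) (delta tdelta : R).

(** Rejected trials only double the constant, so positivity survives and only the last, accepted
    trial matters. *)
Lemma search_final xk M M' y' x' : 0 < M ->
  search delta tdelta Q V psi xk M M' y' x' ->
  [/\ 0 < M', trial tdelta Q V psi xk M' y' x'
    & accepts delta V psi xk M' y' x'].
Proof.
move=> + s; elim: s => {M M' y' x'}[M y' x' tr acc M_gt0|] //.
by move=> M y x M' y' x' _ _ _ IH M_gt0; apply: IH; rewrite mulr_gt0.
Qed.

Variables (x0 : 'rV[R]_n) (L0 : R) (N : nat).
Variables (Ls : nat -> R) (ys xs : nat -> 'rV[R]_n).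
Hypothesis run : adaptive_run delta tdelta Q V psi x0 L0 N Ls ys xs.
Hypothesis L0_gt0 : 0 < L0.

Lemma adaptive_run_gt0 k : (k <= N)%N -> 0 < Ls k.
Proof.
elim: k => [_|k IH kN]; first by rewrite (run_L0 run).
have Lk : 0 < Ls k / 2 by rewrite divr_gt0// IH// ltnW.
by have [] := search_final Lk (run_iter run kN).
Qed.

Lemma adaptive_run_step k : (k < N)%N ->
  trial tdelta Q V psi (xs k) (Ls k.+1) (ys k.+1) (xs k.+1) /\
  accepts delta V psi (xs k) (Ls k.+1) (ys k.+1) (xs k.+1).
Proof.
move=> kN; have Lk : 0 < Ls k / 2 by rewrite divr_gt0// adaptive_run_gt0// ltnW.
by have [] := search_final Lk (run_iter run kN).
Qed.

Lemma adaptive_run_ys k : (k < N)%N -> Q (ys k.+1).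
Proof. by move=> /adaptive_run_step[[[]]]. Qed.

Lemma adaptive_run_xs k : Q x0 -> (k <= N)%N -> Q (xs k).
Proof.
move=> Qx0; case: k => [_|k kN]; first by rewrite (run_x0 run).
by have [[_ []]] := adaptive_run_step kN.
Qed.

End Search.

(** * Per-iteration estimate, telescoping, and transfer to the averaged point *)

Theorem mainTheorem1 (R : realType) (n : nat)
    (Q : set 'rV[R]_n) (Q_neq0 : Q !=set0)
    (Q_convex : convex_set (Q : set (convex_lmodType 'rV[R]_n)))
    (Q_compact : compact Q)
    (nrm : 'rV[R]_n -> R) (nrm_norm : is_norm nrm)
    (d : 'rV[R]_n -> R) (gd : 'rV[R]_n -> 'rV[R]_n)
    (d_diff : forall y, Q y -> is_gradient Q d y (gd y))
    (d_sconvex : strongly_convex nrm 1 Q d)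
    (L delta tdelta eps : R)
    (L_gt0 : 0 < L) (delta_gt0 : 0 < delta) (tdelta_ge0 : 0 <= tdelta)
    (eps_gt0 : 0 < eps)
    (psi : 'rV[R]_n -> 'rV[R]_n -> R)
    (psi_convex : forall y, Q y ->
       convex_function (Q : set (convex_lmodType 'rV[R]_n))
         (fun x => psi x y))
    (psi_diag : forall x, Q x -> psi x x = 0)
    (psi_monotone : forall x y, Q x -> Q y -> psi x y + psi y x <= 0)
    (psi_relsmooth : forall x y z, Q x -> Q y -> Q z ->
       psi x y <= psi x z + psi z y + L * bregman d gd x z
                  + L * bregman d gd z y + delta)
    (psi_solution : exists2 xstar, Q xstar & forall x, Q x -> 0 <= psi x xstar)
    (x0 : 'rV[R]_n) (x0_argmin : is_argmin Q d x0)
    (L0 : R) (L0_gt0 : 0 < L0) (L0_le : L0 <= 2 * L)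
    (N : nat) (N_gt0 : (0 < N)%N)
    (Ls : nat -> R) (ys xs : nat -> 'rV[R]_n)
    (run : adaptive_run delta tdelta Q (bregman d gd) psi x0 L0 N Ls ys xs)
    (stopped :
       sup [set bregman d gd x x0 | x in Q] / eps <= inv_sum Ls N) :
  let S := inv_sum Ls N in
  let ytilde := S^-1 *: \sum_(k < N) (Ls k.+1)^-1 *: ys k.+1 in
  forall x, Q x ->
    [/\ - (S^-1 * \sum_(k < N) psi x (ys k.+1) / Ls k.+1)
          <= bregman d gd x x0 / S + 2 * tdelta + delta,
        psi ytilde x <= bregman d gd x x0 / S + 2 * tdelta + delta &
        bregman d gd x x0 / S + 2 * tdelta + delta
          <= eps + 2 * tdelta + delta].
Proof.
have Qx0 : Q x0 by case: x0_argmin.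
set V := bregman d gd in run stopped *.
move=> S ytilde x Qx.
have Ls_gt0 k : (k < N)%N -> 0 < Ls k.+1 :=
  adaptive_run_gt0 run L0_gt0 (k := k.+1).
have Qys k : (k < N)%N -> Q (ys k.+1) :=
  adaptive_run_ys run L0_gt0 (k := k).
have Qxs k : (k <= N)%N -> Q (xs k) :=
  adaptive_run_xs run L0_gt0 (k := k) Qx0.
have step k : (k < N)%N ->
    - (psi x (ys k.+1) / Ls k.+1)
      <= V x (xs k) - V x (xs k.+1) + (2 * tdelta + delta) / Ls k.+1.
  move=> kN; have Lk := Ls_gt0 _ kN.
  have [[ymin xmin] acc] := adaptive_run_step run L0_gt0 kN.
  have Qxk := Qxs _ (ltnW kN).
  have hy := inexact_argmin_three_point d_diff Q_convex Lk
    (psi_convex _ Qxk) ymin (Qxs _ kN).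
  have hx := inexact_argmin_three_point d_diff Q_convex Lk
    (psi_convex _ (Qys _ kN)) xmin Qx.
  rewrite -(ler_pM2r Lk) mulrDl mulNr !divfK ?gt_eqF//.
  (* On adding [hx], [hy] and the acceptance test, all values of [psi] and [V] that do not involve
     [x] cancel; the two uses of inexactness give [2 * tdelta]. *)
  by move: acc; rewrite /accepts; move: hx hy; rewrite -/V; lra.
have S_bound : - \sum_(k < N) psi x (ys k.+1) / Ls k.+1
    <= V x x0 + S * (2 * tdelta + delta).
  (* The induction keeps [V x (xs m)]; it is discarded only at [m = N], by nonnegativity of [V]. *)
  have tele : forall m, (m <= N)%N ->
      - \sum_(k < m) psi x (ys k.+1) / Ls k.+1
      <= V x x0 - V x (xs m) + inv_sum Ls m * (2 * tdelta + delta).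
    elim=> [_|m IH mN].
      by rewrite /inv_sum !big_ord0 (run_x0 run) subrr mul0r oppr0 addr0.
    rewrite /inv_sum !big_ord_recr/= -/(inv_sum Ls m).
    by have := IH (ltnW mN); have := step _ mN; lra.
  have := tele N (leqnn N); rewrite -/S.
  have := bregman_ge0 d_diff Q_convex d_sconvex Qx (Qxs _ (leqnn N)).
  by rewrite -/V; lra.
(* [weighted_jensen] averages [N'.+1] points, so the sum is never empty. *)
have [N' NE] : exists N', N = N'.+1 by case: (N) N_gt0 => // m _; exists m.
have psi_x : convex_function (Q : set (convex_lmodType 'rV[R]_n)) (psi ^~ x).
  exact: psi_convex.
have [S_gt0 _ jensen] : [/\ 0 < S, Q ytilde &
    S * psi ytilde x <= \sum_(k < N) (Ls k.+1)^-1 * psi (ys k.+1) x].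
  have wL k : (k <= N')%N -> 0 < (Ls k.+1)^-1.
    by move=> kN; rewrite invr_gt0 Ls_gt0// NE.
  have Qz k : (k <= N')%N -> Q (ys k.+1) by move=> kN; apply: Qys; rewrite NE.
  have := weighted_jensen (w := fun k => (Ls k.+1)^-1)
    (z := fun k => ys k.+1) Q_convex psi_x wL Qz.
  by rewrite -NE.
(* Shared by both bounds: [a] is the negated weighted sum for the first, [S * psi ytilde x] for the
   second. *)
have avg_bound (a : R) : a <= V x x0 + S * (2 * tdelta + delta) ->
    S^-1 * a <= V x x0 / S + 2 * tdelta + delta.
  rewrite [S^-1 * a]mulrC ler_pdivrMr// => /le_trans; apply.
  rewrite [leRHS](_ : _ = V x x0 + S * (2 * tdelta + delta))//.
  by field; rewrite gt_eqF.
split.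
- by rewrite -mulrN; exact: avg_bound.
- rewrite -(mulKf (lt0r_neq0 S_gt0) (psi ytilde x)); apply: avg_bound.
  apply: le_trans S_bound; apply: (le_trans jensen).
  rewrite -sumrN; apply: ler_sum => k _.
  have Qk := Qys k (ltn_ord k).
  rewrite mulrC -mulNr ler_pM2r ?invr_gt0 ?Ls_gt0//.
  (* Monotonicity replaces [psi (ys k.+1) x] by the larger [- psi x (ys k.+1)], termwise. *)
  by have := psi_monotone _ _ Qx Qk; lra.
(* The claim [V x x0 / S <= eps] is turned into [V x x0 / eps <= S], the form of the stopping
   rule. *)
- rewrite !lerD2r ler_pdivrMr// mulrC -ler_pdivrMr//.
  apply: le_trans stopped; rewrite ler_pM2r ?invr_gt0//.
  have [_ V_ub] := has_sup_bregman d_diff x0 Q_neq0 Q_compact.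
  by apply: ub_le_sup => //; exists x.
Qed.
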